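(* Let $0\le\rho\le1$, $m\in\mathbb R$. If $\chi\in\operatorname{Sp}(d,\mathbb R)$, $N\ge0$, $a\in\Gamma^m_\rho(\mathbb R^{2d+N})$ and $\mathscr K_{\varphi,a}\in\mathscr I^m_\rho(\chi)$ (where $\varphi$ is a phase function on $\mathbb R^{2d+N}$ that parametrizes $\Lambda_\chi'$), then the formal adjoint satisfies $$\mathscr K_{\varphi,a}^*=\mathscr K_{\psi,b}\in\mathscr I^m_\rho(\chi^{-1}),$$ where $\psi(x,y,\theta)=-\varphi(y,x,\theta)$ and $b(x,y,\theta)=\overline{a(y,x,\theta)}$.
   Context: Notation. $\langle x\rangle=\sqrt{1+|x|^2}$; $(\cdot,\cdot)$ is the sesquilinear pairing between $\mathscr S'$ and $\mathscr S$ (and the $L^2$ inner product), conjugate linear in the second argument. $T^*\mathbb R^d=\mathbb R^d\times\mathbb R^d$ carries $\sigma((x,\xi),(x',\xi'))=\langle x',\xi\rangle-\langle x,\xi'\rangle$; $\operatorname{Sp}(d,\mathbb R)$ is the group of real $2d\times2d$ matrices preserving $\sigma$. Shubin amplitudes: $a\in\Gamma^m_\rho(\mathbb R^n)$ means $a\in C^\infty(\mathbb R^n)$ and $|\partial^\alpha a(x)|\lesssim\langle x\rangle^{m-\rho|\alpha|}$ for all $\alpha\in\mathbb N^n$. Phase functions: for $N\ge0$, a phase function on $\mathbb R^{2d+N}$ is a real quadratic form $\varphi(X,\theta)=\frac12\langle X,FX\rangle+\langle L\theta,X\rangle+\frac12\langle\theta,Q\theta\rangle$, $X=(x,y)\in\mathbb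 R^{2d}$, $\theta\in\mathbb R^N$, with $F\in\mathbb R^{2d\times2d}$, $Q\in\mathbb R^{N\times N}$ symmetric, $L\in\mathbb R^{2d\times N}$, such that the block matrix $\begin{pmatrix}L\\Q\end{pmatrix}$ is injective (if $N=0$, $L$ and $Q$ are absent). It parametrizes the Lagrangian $\Lambda_\varphi=\{(X,\varphi_X'(X,\theta))\in T^*\mathbb R^{2d}:\varphi_\theta'(X,\theta)=0\}$. Oscillatory integrals: for $a\in\Gamma^m_\rho(\mathbb R^{2d+N})$, $K_{\varphi,a}\in\mathscr S'(\mathbb R^{2d})$ is $(K_{\varphi,a},f)=\lim_{\varepsilon\to0+}\int\kappa(\varepsilon\theta)e^{i\varphi(X,\theta)}a(X,\theta)\overline{f(X)}\,d\theta\,dX$, $f\in\mathscr S(\mathbb R^{2d})$, with $\kappa\in\mathscr S(\mathbb R^N)$ equal to $1$ for $|\theta|\le1$ (independent of $\kappa$); if $N=0$, $K_{\varphi,a}(X)=e^{i\varphi(X)}a(X)$. FIOs: $\Lambda_\chi'=\{(x,y,\xi,-\eta)\in T^*\mathbb R^{2d}:(x,\xi)=\chi(y,\eta)\}$; $K^m_\rho(\chi)$ is the set of all $K_{\varphi,a}$ with $N\ge0$, $a\in\Gamma^m_\rho(\mathbb R^{2d+N})$ and $\varphi$ a phase function on $\mathbb R^{2d+N}$ with $\Lambda_\varphi=\Lambda_\chi'$. $\mathscr I^m_\rho(\chi)$ is the set of operators $\mathscr K_{\varphi,a}$ with kernel $K_{\varphi,a}\in K^m_\rho(\chi)$, i.e.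 $(\mathscr K_{\varphi,a}f,g)=(K_{\varphi,a},g\otimes\overline f)$ for $f,g\in\mathscr S(\mathbb R^d)$. The formal adjoint $\mathscr K^*$ is defined by $(\mathscr Kf,g)=(f,\mathscr K^*g)$ for $f,g\in\mathscr S(\mathbb R^d)$. *)

(* Defs.v *)
From HB Require Import structures.
From mathcomp Require Import all_boot all_order all_algebra.
From mathcomp Require Import complex.
From mathcomp Require Import all_classical all_reals all_analysis.
From mathcomp Require Import ring lra.

(* Column vectors 'cV[R]_n stand for R^n and R[i] for the complex numbers.    *)
(* Library matrices carry the sup norm, so Euclidean quantities go through    *)
(* dotv. A point (x, y, theta) of R^(2d+N) is col_mx (col_mx x y) theta; the   *)
(* first d coordinates of T^*R^d are positions, the last d are momenta.        *)

Set Implicit Arguments.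
Unset Strict Implicit.
Unset Printing Implicit Defensive.

Import Order.TTheory GRing.Theory Num.Theory.
Import numFieldNormedType.Exports.

Local Open Scope classical_set_scope.
Local Open Scope ring_scope.
Local Open Scope complex_scope.

Local Notation Re := complex.Re.
Local Notation Im := complex.Im.

Section lebesgue_tuple.
Variable R : realType.

Section cons_measure.
Local Open Scope ereal_scope.
Variables (n : nat).
Variable mu : {sigma_finite_measure set (n.-tuple (measurableTypeR R)) -> \bar R}.

(* The product of Lebesgue measure on R with mu, carried to (n+1)-tuples. *)
Let cons_pair (p : measurableTypeR R * n.-tuple (measurableTypeR R)) :
  n.+1.-tuple (measurableTypeR R) := [the _.-tuple _ of p.1 :: p.2].

Let measurable_cons_pair : measurable_fun setT cons_pair.
Proof. exact: measurable_cons. Qed.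

Definition cons_measure := pushforward (@lebesgue_measure R \x mu) cons_pair.

Let cons_measure0 : cons_measure set0 = 0.
Proof. by rewrite /cons_measure /pushforward preimage_set0 measure0. Qed.

Let cons_measure_ge0 A : 0 <= cons_measure A.
Proof. exact: measure_ge0. Qed.

Let cons_measure_sigma_additive : semi_sigma_additive cons_measure.
Proof. exact: measure_semi_sigma_additive. Qed.

HB.instance Definition _ := isMeasure.Build _ _ _ cons_measure
  cons_measure0 cons_measure_ge0 cons_measure_sigma_additive.

Let cons_measure_sigma_finite : sigma_finite setT cons_measure.
Proof.
have /sigma_finiteP[F [TF ndF Foo]] := sigma_finiteT (@lebesgue_measure R).
have /sigma_finiteP[G [TG ndG Goo]] := sigma_finiteT mu.
pose unc (t : n.+1.-tuple (measurableTypeR R)) := (tnth t ord0, [tuple of behead t]).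
have munc : measurable_fun setT unc.
  by apply/measurable_fun_pairP; split;
    [exact: measurable_tnth|exact: measurable_behead].
exists (fun k => unc @^-1` (F k `*` G k)).
  apply/esym; rewrite -subTset => t _.
  have [i _ Fi] : (\bigcup_i F i) (unc t).1 by rewrite -TF.
  have [j _ Gj] : (\bigcup_i G i) (unc t).2 by rewrite -TG.
  exists (maxn i j) => //; split.
  - by move: Fi; exact/subsetPset/ndF/leq_maxl.
  - by move: Gj; exact/subsetPset/ndG/leq_maxr.
move=> k; have [mF Fk] := Foo k; have [mG Gk] := Goo k.
split; first by rewrite -[X in measurable X]setTI; apply: munc => //; exact: measurableX.
rewrite /cons_measure /pushforward (_ : _ @^-1` _ = F k `*` G k).
  by rewrite product_measure1E// lte_mul_pinfty// ge0_fin_numE.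
apply/seteqP; split=> -[x t]/=; rewrite /unc /cons_pair/= => -[? Gt]; split => //.
- by rewrite (_ : t = [tuple of behead (x :: t)])//; exact/val_inj.
- by rewrite (_ : [tuple of _] = t)//; exact/val_inj.
Qed.

HB.instance Definition _ := Measure_isSigmaFinite.Build _ _ _ cons_measure
  cons_measure_sigma_finite.
End cons_measure.

(* Lebesgue measure on the Borel sets of R^n; for n = 0 it is the unit mass at
   the only point, so integrals over R^0 are evaluations. *)
Fixpoint lebesgue_tuple (n : nat) :
    {sigma_finite_measure set (n.-tuple (measurableTypeR R)) -> \bar R} :=
  match n with
  | 0 => [the {sigma_finite_measure set _ -> \bar R} of
           \d_([tuple] : 0.-tuple (measurableTypeR R))]
  | n'.+1 => [the {sigma_finite_measure set _ -> \bar R} of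
               cons_measure (lebesgue_tuple n')]
  end.

End lebesgue_tuple.

Section calculus.
Variable R : realType.
Implicit Types n : nat.

Definition cmod (x : R[i]) : R := Normc.normc x.

Definition expi (t : R) : R[i] := cos t +i* sin t.

Definition dotv n (v w : 'cV[R]_n) : R := \sum_i v i 0 * w i 0.

Definition bracket n (v : 'cV[R]_n) : R := Num.sqrt (1 + dotv v v).

Definition cintegral n (F : 'cV[R]_n -> R[i]) : R[i] :=
  (\int[lebesgue_tuple R n]_t Re (F (\col_i tnth t i)))%R +i*
  (\int[lebesgue_tuple R n]_t Im (F (\col_i tnth t i)))%R.

(* R[i] has no normed-module structure over R in the library: derivatives, limits
   and integrals of complex-valued functions are taken componentwise. *)
Definition cderive n (v : 'cV[R]_n) (f : 'cV[R]_n -> R[i]) : 'cV[R]_n -> R[i] :=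
  fun x => 'D_v (fun y => Re (f y)) x +i* 'D_v (fun y => Im (f y)) x.

(* A multi-index alpha is encoded as a word [:: i1; ...; ik] of coordinates, with
   |alpha| = k; partials s f is the iterated partial derivative
   d_i1 (... (d_ik f)). The order is immaterial for smooth f. *)
Definition partials n (s : seq 'I_n) (f : 'cV[R]_n -> R[i]) :=
  foldr (fun i => cderive (delta_mx i 0)) f s.

(* C^infty: every iterated partial derivative is (Frechet) differentiable. *)
Definition smooth n (f : 'cV[R]_n -> R[i]) := forall s x,
  differentiable (fun y => Re (partials s f y)) x /\
  differentiable (fun y => Im (partials s f y)) x.

Definition is_schwartz n (f : 'cV[R]_n -> R[i]) := smooth f /\
  forall (k : nat) (s : seq 'I_n), exists C : R,
    forall x, bracket x ^+ k * cmod (partials s f x) <= C.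

Record schwartz n := Schwartz {
  schwartz_fun :> 'cV[R]_n -> R[i] ;
  schwartzP : is_schwartz schwartz_fun }.

(* M bounds the Schwartz seminorm
   p_k(f) = max_{|alpha| <= k} sup_x <x>^k |d^alpha f (x)|. *)
Definition seminorm_le n (k : nat) (f : 'cV[R]_n -> R[i]) (M : R) :=
  forall s : seq 'I_n, (size s <= k)%N ->
  forall x, bracket x ^+ k * cmod (partials s f x) <= M.

(* u f is the pairing (u, f), conjugate linear in f. *)
Definition conj_linear n (u : schwartz n -> R[i]) :=
  forall (c : R[i]) (f g h : schwartz n),
  (forall x, h x = c * f x + g x) -> u h = c^* * u f + u g.

(* |(u, f)| <= C p_k(f): continuity of u for the Schwartz topology. *)
Definition seminorm_bounded n (u : schwartz n -> R[i]) :=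
  exists (C : R) (k : nat), forall (f : schwartz n) (M : R),
  seminorm_le k f M -> cmod (u f) <= C * M.

Record tempered n := Tempered {
  tempered_fun :> schwartz n -> R[i] ;
  tempered_conj_linear : conj_linear tempered_fun ;
  tempered_bounded : seminorm_bounded tempered_fun }.

Lemma cmod_ge0 (x : R[i]) : 0 <= cmod x.
Proof. by case: x => a b; exact: sqrtr_ge0. Qed.

Lemma cmodM (x y : R[i]) : cmod (x * y) = cmod x * cmod y.
Proof. exact: Normc.normcM. Qed.

Lemma cmod_conj (x : R[i]) : cmod x^* = cmod x.
Proof. by case: x => a b; rewrite /cmod/= sqrrN. Qed.

Lemma dotv_ge0 n (v : 'cV[R]_n) : 0 <= dotv v v.
Proof. by apply: sumr_ge0 => i _; rewrite -expr2 sqr_ge0. Qed.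

Lemma bracket_ge0 n (v : 'cV[R]_n) : 0 <= bracket v.
Proof. exact: sqrtr_ge0. Qed.

Lemma bracket_ge1 n (v : 'cV[R]_n) : 1 <= bracket v.
Proof. by rewrite -[leLHS]sqrtr1 ler_wsqrtr// lerDl dotv_ge0. Qed.

Lemma bracket_split p q (z : 'cV[R]_(p + q)) :
  bracket z <= bracket (usubmx z) * bracket (dsubmx z).
Proof.
rewrite /bracket -sqrtrM ?addr_ge0 ?dotv_ge0// ler_wsqrtr//.
rewrite [X in 1 + X <= _](_ : _ = dotv (usubmx z) (usubmx z) + dotv (dsubmx z) (dsubmx z)); last first.
  rewrite /dotv big_split_ord/=; congr (_ + _); apply: eq_bigr => i _; by rewrite !mxE.
have := dotv_ge0 (usubmx z); have := dotv_ge0 (dsubmx z).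
by move: (dotv _ _) (dotv _ _) => a b a0 b0; nra.
Qed.

Lemma continuous_usubmx p q : continuous (usubmx : 'cV[R]_(p + q) -> 'cV[R]_p).
Proof.
move=> u A /nbhs_ballP[e /= e0 eA].
apply/nbhs_ballP; exists e => //= v [_ uv]; apply: eA; split => // i j.
by apply: (le_lt_trans _ (uv (lshift q i) j)); rewrite !mxE.
Qed.

Lemma continuous_dsubmx p q : continuous (dsubmx : 'cV[R]_(p + q) -> 'cV[R]_q).
Proof.
move=> u A /nbhs_ballP[e /= e0 eA].
apply/nbhs_ballP; exists e => //= v [_ uv]; apply: eA; split => // i j.
by apply: (le_lt_trans _ (uv (rshift p i) j)); rewrite !mxE.
Qed.

Lemma differentiable_usubmx p q (z : 'cV[R]_(p + q)) :
  differentiable (usubmx : 'cV[R]_(p + q) -> 'cV[R]_p) z.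
Proof. exact/linear_differentiable/continuous_usubmx. Qed.

Lemma differentiable_dsubmx p q (z : 'cV[R]_(p + q)) :
  differentiable (dsubmx : 'cV[R]_(p + q) -> 'cV[R]_q) z.
Proof. exact/linear_differentiable/continuous_dsubmx. Qed.

Lemma derive_comp_linear m n (L : {linear 'cV[R]_m -> 'cV[R]_n})
    (f : 'cV[R]_n -> R) a v :
  'D_v (fun x => f (L x)) a = 'D_(L v) f (L a).
Proof.
rewrite /derive (_ : (fun h => _ *: (_ - f (L a))) =
  fun h => h^-1 *: ((f \o shift (L a)) (h *: L v) - f (L a)))//.
by apply/funext => h /=; rewrite linearP.
Qed.

Lemma usubmx_delta_l p q (i : 'I_p) :
  usubmx (delta_mx (lshift q i) 0 : 'cV[R]_(p + q)) = delta_mx i 0.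
Proof. by apply/matrixP => k j; rewrite !mxE (inj_eq (@lshift_inj _ _)). Qed.

Lemma usubmx_delta_r p q (i : 'I_q) :
  usubmx (delta_mx (rshift p i) 0 : 'cV[R]_(p + q)) = 0.
Proof. by apply/matrixP => k j; rewrite !mxE eq_lrshift. Qed.

Lemma dsubmx_delta_r p q (i : 'I_q) :
  dsubmx (delta_mx (rshift p i) 0 : 'cV[R]_(p + q)) = delta_mx i 0.
Proof. by apply/matrixP => k j; rewrite !mxE (inj_eq (@rshift_inj _ _)). Qed.

Lemma dsubmx_delta_l p q (i : 'I_p) :
  dsubmx (delta_mx (lshift q i) 0 : 'cV[R]_(p + q)) = 0.
Proof. by apply/matrixP => k j; rewrite !mxE eq_rlshift. Qed.

Lemma ReM (x y : R[i]) : Re (x * y) = Re x * Re y - Im x * Im y.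
Proof. by case: x y => ? ? []. Qed.

Lemma ImM (x y : R[i]) : Im (x * y) = Re x * Im y + Im x * Re y.
Proof. by case: x y => ? ? [] ? ?; rewrite /= . Qed.

Lemma partials_conj n (s : seq 'I_n) (f : 'cV[R]_n -> R[i]) : smooth f ->
  partials s (fun x => (f x)^*) = fun x => (partials s f x)^*.
Proof.
move=> sf; elim: s => //= i s ->; apply/funext => x; rewrite /cderive.
have [dR dI] := sf s x.
rewrite [X in _ +i* X](_ : _ = - 'D_(delta_mx i 0) (fun y => Im (partials s f y)) x).
  rewrite [X in X +i* _](_ : _ = 'D_(delta_mx i 0) (fun y => Re (partials s f y)) x)//.
  by congr ('D_ _ _ _); apply/funext => y; case: (partials s f y).
rewrite -deriveN; last exact: diff_derivable.
by congr ('D_ _ _ _); apply/funext => y; rewrite /GRing.opp/=; case: (partials s f y).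
Qed.

Lemma is_schwartz_conj n (f : schwartz n) : is_schwartz (fun x => (f x)^*).
Proof.
case: f => f [sf bf]; split => /= [s x|k s].
  rewrite partials_conj//; have [dR dI] := sf s x; split.
    rewrite (_ : (fun _ => _) = fun y => Re (partials s f y))//.
    by apply/funext => y; case: (partials s f y).
  rewrite (_ : (fun _ => _) = - (fun y => Im (partials s f y))); first exact: differentiableN.
  by apply/funext => y; rewrite /GRing.opp/=; case: (partials s f y).
have [C fC] := bf k s; exists C => x; rewrite partials_conj// cmod_conj; exact: fC.
Qed.

Definition schwartz_conj n (f : schwartz n) : schwartz n :=
  Schwartz (is_schwartz_conj f).

Definition tens p q (g : 'cV[R]_p -> R[i]) (h : 'cV[R]_q -> R[i])
    (z : 'cV[R]_(p + q)) : R[i] := g (usubmx z) * h (dsubmx z).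

Section tensor.
Variables (p q : nat).

Let lword (s : seq 'I_(p + q)) : seq 'I_p :=
  pmap (fun i : 'I_(p + q) => if fintype.split i is inl j then Some j else None) s.
Let rword (s : seq 'I_(p + q)) : seq 'I_q :=
  pmap (fun i : 'I_(p + q) => if fintype.split i is inr j then Some j else None) s.

Let differentiable_u (f : 'cV[R]_p -> R) (z : 'cV[R]_(p + q)) :
  differentiable f (usubmx z) -> differentiable (fun z => f (usubmx z)) z.
Proof. by move=> df; apply: differentiable_comp => //; exact: differentiable_usubmx. Qed.

Let differentiable_d (f : 'cV[R]_q -> R) (z : 'cV[R]_(p + q)) :
  differentiable f (dsubmx z) -> differentiable (fun z => f (dsubmx z)) z.
Proof. by move=> df; apply: differentiable_comp => //; exact: differentiable_dsubmx. Qed.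

Lemma partials_tens (g : 'cV[R]_p -> R[i]) (h : 'cV[R]_q -> R[i]) s :
  smooth g -> smooth h ->
  partials s (tens g h) = tens (partials (lword s) g) (partials (rword s) h).
Proof.
move=> sg sh; elim: s => //= i s ->; apply/funext => z.
have [gR gI] := sg (lword s) (usubmx z).
have [hR hI] := sh (rword s) (dsubmx z).
rewrite [LHS]/cderive /tens.
move: gR gI hR hI; set G := partials _ g; set H := partials _ h => gR gI hR hI.
have ugR := differentiable_u gR; have ugI := differentiable_u gI.
have dhR := differentiable_d hR; have dhI := differentiable_d hI.
have dM (a b : 'cV[R]_(p + q) -> R) v : differentiable a z -> differentiable b z ->
    'D_v (fun y => a y * b y) z = a z * 'D_v b z + b z * 'D_v a z.
  by move=> da db; rewrite (@deriveM _ _ a b)//; exact: diff_derivable.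
rewrite [X in X +i* _](_ : _ = 'D_(delta_mx i 0) ((fun y => Re (G (usubmx y)) * Re (H (dsubmx y)))
   - (fun y => Im (G (usubmx y)) * Im (H (dsubmx y)))) z); last first.
  by congr ('D_ _ _ _); apply/funext => y; rewrite ReM.
rewrite [X in _ +i* X](_ : _ = 'D_(delta_mx i 0) ((fun y => Re (G (usubmx y)) * Im (H (dsubmx y)))
   + (fun y => Im (G (usubmx y)) * Re (H (dsubmx y)))) z); last first.
  by congr ('D_ _ _ _); apply/funext => y; rewrite ImM.
rewrite deriveB ?deriveD; try by apply/diff_derivable/differentiableM.
rewrite !dM//.
have L (f : 'cV[R]_p -> R) v : 'D_v (fun y : 'cV[R]_(p + q) => f (usubmx y)) z = 'D_(usubmx v) f (usubmx z).
  exact: (@derive_comp_linear _ _ (usubmx : {linear 'cV[R]_(p + q) -> 'cV[R]_p})).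
have K (f : 'cV[R]_q -> R) v : 'D_v (fun y : 'cV[R]_(p + q) => f (dsubmx y)) z = 'D_(dsubmx v) f (dsubmx z).
  exact: (@derive_comp_linear _ _ (dsubmx : {linear 'cV[R]_(p + q) -> 'cV[R]_q})).
rewrite (L (fun x => Re (G x))) (L (fun x => Im (G x))) (K (fun x => Re (H x))) (K (fun x => Im (H x))).
rewrite /lword /rword/=; case: splitP => j ij.
- have -> : i = lshift q j by exact: val_inj.
  rewrite usubmx_delta_l dsubmx_delta_l !derive0/= -/(lword s) -/(rword s) -/G -/H /cderive.
  by apply/eqP; rewrite eq_complex ReM ImM/=; apply/andP; split; apply/eqP; ring.
- have -> : i = rshift p j by exact: val_inj.
  rewrite usubmx_delta_r dsubmx_delta_r !derive0/= -/(lword s) -/(rword s) -/G -/H /cderive.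
  by apply/eqP; rewrite eq_complex ReM ImM/=; apply/andP; split; apply/eqP; ring.
Qed.

Lemma smooth_tens (g : 'cV[R]_p -> R[i]) (h : 'cV[R]_q -> R[i]) :
  smooth g -> smooth h -> smooth (tens g h).
Proof.
move=> sg sh s z; rewrite partials_tens//.
have [/differentiable_u gR /differentiable_u gI] := sg (lword s) (usubmx z).
have [/differentiable_d hR /differentiable_d hI] := sh (rword s) (dsubmx z).
split.
  under eq_fun do rewrite ReM.
  by apply: differentiableB; exact: differentiableM.
under eq_fun do rewrite ImM.
by apply: differentiableD; exact: differentiableM.
Qed.

Lemma partials_tens_le (g : 'cV[R]_p -> R[i]) (h : 'cV[R]_q -> R[i]) k s C D :
  smooth g -> smooth h ->
  (forall x, bracket x ^+ k * cmod (partials (lword s) g x) <= C) ->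
  (forall x, bracket x ^+ k * cmod (partials (rword s) h x) <= D) ->
  forall z, bracket z ^+ k * cmod (partials s (tens g h) z) <= C * D.
Proof.
move=> sg sh gC hD z; rewrite partials_tens// /tens cmodM.
apply: le_trans (ler_pM _ _ (gC (usubmx z)) (hD (dsubmx z))); last 2 first.
- by rewrite mulr_ge0 ?exprn_ge0 ?bracket_ge0 ?cmod_ge0.
- by rewrite mulr_ge0 ?exprn_ge0 ?bracket_ge0 ?cmod_ge0.
rewrite mulrACA -exprMn ler_wpM2r ?mulr_ge0 ?cmod_ge0//.
by rewrite lerXn2r ?nnegrE ?mulr_ge0 ?bracket_ge0 ?bracket_split.
Qed.

Lemma is_schwartz_tens (g : schwartz p) (h : schwartz q) :
  is_schwartz (tens g h).
Proof.
case: g => g [sg bg]; case: h => h [sh bh]; split; first exact: smooth_tens.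
move=> k s; have [C gC] := bg k (lword s); have [D hD] := bh k (rword s).
exists (C * D); exact: partials_tens_le.
Qed.

Definition schwartz_tens (g : schwartz p) (h : schwartz q) :=
  Schwartz (is_schwartz_tens g h).

Lemma seminorm_le_tens k (g : schwartz p) (h : schwartz q) C D :
  seminorm_le k g C -> seminorm_le k h D -> seminorm_le k (schwartz_tens g h) (C * D).
Proof.
move=> gC hD s sk; apply: partials_tens_le.
- by case: (schwartzP g).
- by case: (schwartzP h).
- by apply: gC; rewrite size_pmap (leq_trans (count_size _ _)).
- by apply: hD; rewrite size_pmap (leq_trans (count_size _ _)).
Qed.

End tensor.

Lemma seminorm_le_ex n k (f : schwartz n) : exists M, seminorm_le k f M.
Proof.
have [C fC] := choice ((schwartzP f).2 k).
exists (\sum_(j < k.+1) \sum_(t : j.-tuple 'I_n) `|C t|) => s sk x.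
apply: (le_trans (fC s x)); apply: (le_trans (ler_norm _)).
have jk : (size s < k.+1)%N by [].
rewrite (bigD1 (Ordinal jk))//= (bigD1 (in_tuple s))//= -addrA lerDl.
by rewrite addr_ge0// ?sumr_ge0// => j _; rewrite sumr_ge0.
Qed.

Lemma tempered0_subproof n :
  conj_linear (fun _ : schwartz n => 0) /\ seminorm_bounded (fun _ : schwartz n => 0).
Proof.
split=> [c f g h _|]; first by rewrite mulr0 addr0.
by exists 0, 0%N => f M _; rewrite mul0r /cmod Normc.normc0.
Qed.

Definition tempered0 n : tempered n :=
  Tempered (tempered0_subproof n).1 (tempered0_subproof n).2.

HB.instance Definition _ n := gen_eqMixin (tempered n).
HB.instance Definition _ n := gen_choiceMixin (tempered n).

End calculus.

Section fourier_integral_operators.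
Variable R : realType.
Implicit Types d N : nat.

Definition sympl d (v w : 'cV[R]_(d + d)) : R :=
  dotv (usubmx w) (dsubmx v) - dotv (usubmx v) (dsubmx w).

Definition Sp d : set 'M[R]_(d + d) :=
  [set chi | forall v w, sympl (chi *m v) (chi *m w) = sympl v w].

Definition Shubin n (m rho : R) : set ('cV[R]_n -> R[i]) :=
  [set a | smooth a /\ forall s : seq 'I_n, exists C : R,
    forall x, cmod (partials s a x) <= C * bracket x `^ (m - rho * (size s)%:R)].

Definition phase_function d N (phi : 'cV[R]_(d + d + N) -> R) :=
  exists (F : 'M[R]_(d + d)) (L : 'M[R]_(d + d, N)) (Q : 'M[R]_N),
  [/\ F^T = F, Q^T = Q,
      injective (fun th : 'cV[R]_N => col_mx L Q *m th) &
      forall (X : 'cV[R]_(d + d)) (th : 'cV[R]_N),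
      phi (col_mx X th) = 2^-1 * dotv X (F *m X) + dotv (L *m th) X
                          + 2^-1 * dotv th (Q *m th)].

Definition grad n (f : 'cV[R]_n -> R) (x : 'cV[R]_n) : 'cV[R]_n :=
  \col_i 'D_(delta_mx i 0) f x.

Definition Lagrangian d N (phi : 'cV[R]_(d + d + N) -> R) :
    set ('cV[R]_(d + d) * 'cV[R]_(d + d)) :=
  [set p | exists X th,
    p = (X, grad (fun X' => phi (col_mx X' th)) X) /\
    grad (fun th' => phi (col_mx X th')) th = 0].

Definition twisted_graph d (chi : 'M[R]_(d + d)) :
    set ('cV[R]_(d + d) * 'cV[R]_(d + d)) :=
  [set p | exists x y xi eta : 'cV[R]_d,
    p = (col_mx x y, col_mx xi (- eta)) /\
    col_mx x xi = chi *m col_mx y eta].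

(* The integral over R^(2d+N) of kappa(eps theta) e^(i phi) a conj(f(X)). *)
Definition regularized_integral d N (phi : 'cV[R]_(d + d + N) -> R)
    (a : 'cV[R]_(d + d + N) -> R[i]) (kappa : 'cV[R]_N -> R[i])
    (f : 'cV[R]_(d + d) -> R[i]) (eps : R) : R[i] :=
  cintegral (fun z => kappa (eps *: dsubmx z) * expi (phi z) * a z
                      * (f (usubmx z))^*).

(* For N = 0 the condition on kappa reads kappa = 1 and the integral is that of
   e^(i phi) a conj f over R^(2d), i.e. u is the function e^(i phi) a. *)
Definition oscillatory_limit d N (phi : 'cV[R]_(d + d + N) -> R)
    (a : 'cV[R]_(d + d + N) -> R[i]) : set (tempered R (d + d)) :=
  [set u | forall kappa : schwartz R N,
    (forall th, dotv th th <= 1 -> kappa th = 1) ->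
    forall f : schwartz R (d + d),
    Re (regularized_integral phi a kappa f eps) @[eps --> 0^'+] --> Re (u f) /\
    Im (regularized_integral phi a kappa f eps) @[eps --> 0^'+] --> Im (u f)].

(* Definite description: the only tempered distribution that is the limit for
   every kappa (with 0 as the usual junk value outside the domain of the
   description). *)
Definition oscillatory_integral d N (phi : 'cV[R]_(d + d + N) -> R)
    (a : 'cV[R]_(d + d + N) -> R[i]) : tempered R (d + d) :=
  xget (tempered0 R (d + d)) (unique (oscillatory_limit phi a)).

(* (kernel_op K f, g) = (K, g (x) conj f). *)
Section kernel_operator.
Variables (d : nat) (K : tempered R (d + d)) (f : schwartz R d).

Let pairing (g : schwartz R d) : R[i] := K (schwartz_tens g (schwartz_conj f)).

Let pairing_conj_linear : conj_linear pairing.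
Proof.
move=> c g1 g2 h hE; apply: tempered_conj_linear => z /=.
by rewrite /tens hE mulrDl mulrA.
Qed.

Let pairing_bounded : seminorm_bounded pairing.
Proof.
have [C [k KC]] := tempered_bounded K.
have [M fM] := seminorm_le_ex k (schwartz_conj f).
exists (C * M), k => g B gB; rewrite -mulrA [M * B]mulrC.
exact/KC/seminorm_le_tens.
Qed.

Definition kernel_op : tempered R d := Tempered pairing_conj_linear pairing_bounded.

End kernel_operator.

Definition FIO d N (phi : 'cV[R]_(d + d + N) -> R)
    (a : 'cV[R]_(d + d + N) -> R[i]) : schwartz R d -> tempered R d :=
  kernel_op (oscillatory_integral phi a).

Definition FIO_kernels d (m rho : R) (chi : 'M[R]_(d + d)) :
    set (tempered R (d + d)) :=
  [set K | exists (N : nat) (phi : 'cV[R]_(d + d + N) -> R)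
      (a : 'cV[R]_(d + d + N) -> R[i]),
    [/\ phase_function phi, Lagrangian phi = twisted_graph chi,
        Shubin m rho a & K = oscillatory_integral phi a]].

Definition FIO_class d (m rho : R) (chi : 'M[R]_(d + d)) :
    set (schwartz R d -> tempered R d) :=
  [set kernel_op K | K in FIO_kernels m rho chi].

(* (A f, g) = (f, B g), where (f, v) is the conjugate of (v, f) for v tempered. *)
Definition formal_adjoint d (A B : schwartz R d -> tempered R d) :=
  forall f g : schwartz R d, A f g = (B g f)^*.

End fourier_integral_operators.

(* Main.v *)
Require Import Defs.
From HB Require Import structures.
From mathcomp Require Import all_boot all_order all_algebra.
From mathcomp Require Import complex.
From mathcomp Require Import all_classical all_reals all_analysis.

(** The statement is a symmetry under the substitution (x, y) -> (y, x)
    followed by conjugation. Write S for the exchange of x and y. Conjugating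
    the regularized integral of (-phi o S, conj a o S) against f and changing
    variables by S gives the regularized integral of (phi, a), with cutoff
    conj kappa, against conj f o S (regularized_integral_adjoint). In the limit
    the kernel K of the operator becomes the distribution whose pairing with f
    is conj (K, conj f o S), and testing this on tensor products is the
    definition of the formal adjoint (formal_adjoint_kernel_op).

    An oscillatory integral is here the unique tempered distribution that is
    the limit for every cutoff, or 0 when there is none. The correspondence
    above is an involution on tempered distributions that fixes 0 and exchanges
    the candidate limits of (phi, a) and (-phi o S, conj a o S), so it
    transports the description in both cases (xget_unique_involutive).

    The change of variables needs that Lebesgue measure on tuples is invariant
    under permutations of coordinates, which is checked on boxes
    (lebesgue_tuple_reindex).

    On the symplectic side, grad (-phi o S) = - S (grad phi) o S, so passing to
    the adjoint phase acts on the Lagrangian by (X, Xi) -> (S X, - S Xi). On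
    twisted graphs this map interchanges (x, xi) and (y, eta), that is, it
    replaces chi by its inverse (Lagrangian_adjoint, twisted_graph_flip).

    All occurrences of conj f o S, for amplitudes and test functions, are
    instances of conj_rowsub for an involution of the coordinates. *)

Set Implicit Arguments.
Unset Strict Implicit.
Unset Printing Implicit Defensive.

Import Order.TTheory GRing.Theory Num.Theory.
Import numFieldNormedType.Exports.

Local Open Scope classical_set_scope.
Local Open Scope ring_scope.

Local Notation Re := complex.Re.
Local Notation Im := complex.Im.
Local Notation rowsub f := (mxsub f id).

(** * Integration and permutations of coordinates *)

Section invariant_integral.
Local Open Scope ereal_scope.
Context d (T : measurableType d) (R : realType).
Variables (mu : {measure set T -> \bar R}) (h : T -> T).
Hypothesis mh : measurable_fun setT h.
Hypothesis hK : involutive h.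
Hypothesis mu_h : forall A, measurable A -> mu (h @^-1` A) = mu A.

Import HBNNSimple.

Let nnsfun_comp (g : {nnsfun T >-> R}) :
  exists g' : {nnsfun T >-> R}, (g' : T -> R) = g \o h.
Proof.
have m : measurable_fun setT (g \o h) by exact: measurableT_comp.
have fi : finite_set (range (g \o h)).
  apply: (sub_finite_set _ (fimfunP g)) => _ [x _ <-] /=; exact: imageT.
have nn : forall x, (0 <= (g \o h) x)%R by move=> x /=; exact: fun_ge0.
pose G := HB.pack_for {nnsfun T >-> R} (g \o h)
  (isMeasurableFun.Build _ _ _ _ _ m) (FiniteImage.Build _ _ _ fi)
  (isNonNegFun.Build _ _ _ nn).
by exists G.
Qed.

Let ge0_integral_le (f : T -> \bar R) : (forall x, 0 <= f x) ->
  \int[mu]_x f x <= \int[mu]_x f (h x).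
Proof.
move=> f0; rewrite !ge0_integralTE//; apply: ge_ereal_sup => _ /= [g gf <-].
have [g' g'E] := nnsfun_comp g.
apply: ereal_sup_ubound; exists g'; first by move=> x; rewrite g'E; exact: gf.
rewrite g'E /sintegral; apply: eq_fsbigr => r _.
by rewrite comp_preimage mu_h.
Qed.

Let ge0_integral_involutive (f : T -> \bar R) : (forall x, 0 <= f x) ->
  \int[mu]_x f (h x) = \int[mu]_x f x.
Proof.
move=> f0; apply/eqP; rewrite eq_le ge0_integral_le// andbT.
by apply: le_trans (ge0_integral_le _) _ => //; under eq_integral do rewrite hK.
Qed.

(** The integral of a nonnegative function is the supremum over the simple
    functions below it, and composition with h permutes these and keeps their
    integrals; so the change of variables applies to every f. *)
Lemma integral_involutive (f : T -> \bar R) :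
  \int[mu]_x f (h x) = \int[mu]_x f x.
Proof.
have posE : (fun x => f (h x))^\+ = fun x => f^\+ (h x).
  by apply/funext => x; rewrite !funeposE.
have negE : (fun x => f (h x))^\- = fun x => f^\- (h x).
  by apply/funext => x; rewrite !funenegE.
by rewrite integralE posE negE [RHS]integralE !ge0_integral_involutive.
Qed.

End invariant_integral.

Section boxes.
Context (R : realType).
Implicit Type n : nat.

Definition box n (A : 'I_n -> set R) : set (n.-tuple (measurableTypeR R)) :=
  [set t | forall i, A i (tnth t i)].

Definition measurable_boxes n : set (set (n.-tuple (measurableTypeR R))) :=
  [set box A | A in [set A : 'I_n -> set R | forall i, measurable (A i)]].

Lemma measurable_box n (A : 'I_n -> set R) :
  (forall i, measurable (A i)) -> measurable (box A).
Proof.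
move=> mA.
have -> : box A = \bigcap_(i in [set: 'I_n]) ((@tnth n R)^~ i @^-1` A i).
  by apply/seteqP; split=> t At i => [_|]; [exact: At|exact: (At i I)].
apply: fin_bigcap_measurable => // i _; rewrite -[X in measurable X]setTI.
exact: (@measurable_tnth _ (measurableTypeR R) n i measurableT _ (mA i)).
Qed.

(** The cylinders over one coordinate that generate the product sigma-algebra
    are themselves boxes, with all other sides equal to the line. *)
Lemma measurable_tupleE n :
  @measurable _ (n.-tuple (measurableTypeR R)) = <<s @measurable_boxes n >>.
Proof.
apply/seteqP; split; last first.
  apply: smallest_sub; first exact: sigma_algebra_measurable.
  by move=> _ [A mA <-]; exact: measurable_box.
apply: smallest_sub; first exact: smallest_sigma_algebra.
move=> X; rewrite -bigcup_seq => -[i _ [B mB <-]]; apply: sub_sigma_algebra.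
exists (fun j => if j == i then B else setT); first by move=> j; case: ifP.
rewrite setTI; apply/seteqP; split=> t /=.
  by move/(_ i); rewrite eqxx.
by move=> Bt j; case: eqP => // ->.
Qed.

Lemma setI_closed_boxes n : setI_closed (@measurable_boxes n).
Proof.
move=> _ _ [A mA <-] [B mB <-]; exists (fun i => A i `&` B i).
  by move=> i; exact: measurableI.
apply/seteqP; split=> t; first by move=> AB; split=> i; have [] := AB i.
by move=> [At Bt] i; split; [exact: At|exact: Bt].
Qed.

Lemma lebesgue_tuple_box n (A : 'I_n -> set R) :
  (forall i, measurable (A i)) ->
  (lebesgue_tuple R n (box A) = \prod_(i < n) @lebesgue_measure R (A i))%E.
Proof.
elim: n A => [|n IH] A mA.
  rewrite big_ord0 (_ : box A = setT) /=; first by rewrite diracT.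
  by apply/seteqP; split=> // t _ [].
rewrite big_ord_recl -(IH (fun i => A (lift ord0 i)))//=.
rewrite /cons_measure /pushforward -product_measure1E; first last.
- exact: measurable_box.
- exact: (mA ord0).
congr (product_measure1 _ _ _).
apply/seteqP; split=> -[x t] /=; rewrite /box /=.
  move=> H; split; first exact: (H ord0).
  by move=> i; have := H (lift ord0 i); rewrite tnthS.
by move=> [H0 H] i; case: (unliftP ord0 i) => [j ->|->]; rewrite ?tnthS.
Qed.

Definition tuple_reindex n (s : 'I_n -> 'I_n) (t : n.-tuple (measurableTypeR R)) :
  n.-tuple (measurableTypeR R) := [tuple tnth t (s i) | i < n].

Lemma measurable_tuple_reindex n (s : 'I_n -> 'I_n):
  measurable_fun setT (tuple_reindex s).
Proof.
apply/measurable_fun_tnthP => i.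
rewrite [X in measurable_fun _ X](_ : _ = (@tnth n R)^~ (s i)).
  exact: measurable_tnth.
by apply/funext => t /=; rewrite tnth_mktuple.
Qed.

Lemma tuple_reindexK n (s : 'I_n -> 'I_n) :
  involutive s -> involutive (tuple_reindex s).
Proof. by move=> sK t; apply: eq_from_tnth => i; rewrite !tnth_mktuple sK. Qed.

(** Boxes form a pi-system that generates the Borel sets of tuples, a coordinate
    permutation only reorders the factors in the volume of a box, and the
    cubes [-k, k]^n exhaust the space with finite volume: the two measures
    therefore agree. *)
Lemma lebesgue_tuple_reindex n (s : 'I_n -> 'I_n) A : involutive s ->
  measurable A ->
  lebesgue_tuple R n (tuple_reindex s @^-1` A) = lebesgue_tuple R n A.
Proof.
move=> sK mA.
have reindex_box (B : 'I_n -> set R) : (forall i, measurable (B i)) ->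
    lebesgue_tuple R n (tuple_reindex s @^-1` box B) = lebesgue_tuple R n (box B).
  move=> mB; have -> : tuple_reindex s @^-1` box B = box (B \o s).
    apply/seteqP; split=> t Bt i; have := Bt (s i).
      by rewrite tnth_mktuple sK.
    by rewrite tnth_mktuple /= sK.
  rewrite !lebesgue_tuple_box//; last by move=> i; exact: mB.
  by rewrite [RHS](reindex_inj (inv_inj sK)).
pose P : {mfun _ >-> _} := HB.pack_for {mfun _ >-> _} (tuple_reindex s)
  (isMeasurableFun.Build _ _ _ _ _ (measurable_tuple_reindex s)).
pose g (k : nat) := box (fun _ : 'I_n => `[- k%:R, k%:R]%classic : set R).
apply: (measure_unique (@measurable_boxes n) g _ _ _ _
  (pushforward (lebesgue_tuple R n) P)) => //.
- exact: measurable_tupleE.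
- exact: setI_closed_boxes.
- by move=> k; exists (fun=> `[- k%:R, k%:R]%classic).
- rewrite -subTset => t _; exists (Num.truncn (\sum_i `|tnth t i|)).+1 => // i.
  rewrite /= in_itv /= -ler_norml; apply: (@le_trans _ _ (\sum_i `|tnth t i|)).
    by rewrite (bigD1 i)//= lerDl sumr_ge0.
  exact/ltW/truncnS_gt.
- by move=> _ [B mB <-]; exact: reindex_box.
- move=> k; suff : (lebesgue_tuple R n (g k) < +oo)%E by rewrite -reindex_box.
  rewrite lebesgue_tuple_box// ltey_eq; apply/orP; left.
  elim/big_ind : _ => // [x y|i _]; first exact: fin_numM.
  by rewrite lebesgue_measure_itv/=; case: ifP.
Qed.

End boxes.

Section cintegral_lemmas.
Context (R : realType).

(** When the positive or the negative part of f has infinite integral, both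
    sides are the finite part of an infinite value, that is 0. *)
Lemma RintegralN d (T : measurableType d)
    (mu : {measure set T -> \bar R}) (f : T -> R) :
  (\int[mu]_x - f x = - \int[mu]_x f x)%R.
Proof.
rewrite /Rintegral [in LHS]integralE [in RHS]integralE.
have -> : ((fun x => (- f x)%:E)^\+ = (fun x => (f x)%:E)^\-)%E.
  by rewrite -funeposN.
have -> : ((fun x => (- f x)%:E)^\- = (fun x => (f x)%:E)^\+)%E.
  by rewrite -funenegN.
have := integral_ge0 mu (fun x (_ : setT x) => funepos_ge0 (fun x => (f x)%:E) x).
have := integral_ge0 mu (fun x (_ : setT x) => funeneg_ge0 (fun x => (f x)%:E) x).
case: (\int[mu]_x _)%E => [p||]; case: (\int[mu]_x _)%E => [q||] //= _ _;
  by rewrite ?oppr0 ?opprB.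
Qed.

Lemma cintegral_conj n (F : 'cV[R]_n -> R[i]) :
  cintegral (fun x => conjc (F x)) = conjc (cintegral F).
Proof.
rewrite /cintegral /= -RintegralN; congr Complex;
  by apply: eq_Rintegral => t _; case: (F _).
Qed.

Lemma cintegral_rowsub n (s : 'I_n -> 'I_n) (F : 'cV[R]_n -> R[i]) :
  involutive s -> cintegral (fun x => F (rowsub s x)) = cintegral F.
Proof.
move=> sK; have reindexE t :
    \col_i tnth (tuple_reindex s t) i = rowsub s (\col_i tnth t i) :> 'cV[R]_n.
  by apply/matrixP => i j; rewrite !mxE tnth_mktuple.
have inv (G : 'cV[R]_n -> R) :
    (\int[lebesgue_tuple R n]_t G (rowsub s (\col_i tnth t i)) =
    \int[lebesgue_tuple R n]_t G (\col_i tnth t i))%R.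
  rewrite /Rintegral; congr fine.
  under eq_integral do rewrite -reindexE.
  exact: (@integral_involutive _ _ _ (lebesgue_tuple R n) (tuple_reindex s)
    (measurable_tuple_reindex s) (tuple_reindexK sK)
    (fun A => @lebesgue_tuple_reindex R n s A sK)
    (fun t => (G (\col_i tnth t i))%:E)).
by rewrite /cintegral (inv (fun x => Re (F x))) (inv (fun x => Im (F x))).
Qed.

End cintegral_lemmas.

(** * Conjugation composed with an involution of the coordinates *)

Section conj_rowsub.
Context (R : realType) (n : nat) (s : 'I_n -> 'I_n).
Hypothesis sK : involutive s.

Definition conj_rowsub (f : 'cV[R]_n -> R[i]) (x : 'cV[R]_n) : R[i] :=
  conjc (f (rowsub s x)).

Lemma rowsubK (T : Type) m : involutive (rowsub s : 'M[T]_(n, m) -> 'M[T]_(n, m)).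
Proof. by move=> x; apply/matrixP => i j; rewrite !mxE sK. Qed.

Lemma conj_rowsubK : involutive conj_rowsub.
Proof.
by move=> f; apply/funext => x; rewrite /conj_rowsub rowsubK conjcK.
Qed.

Lemma rowsub_delta (i : 'I_n) :
  rowsub s (delta_mx i 0 : 'cV[R]_n) = delta_mx (s i) 0.
Proof. by apply/matrixP => k j; rewrite !mxE (can2_eq sK sK). Qed.

Lemma dotv_rowsub (v w : 'cV[R]_n) : dotv (rowsub s v) (rowsub s w) = dotv v w.
Proof.
rewrite /dotv [RHS](reindex_inj (inv_inj sK)).
by apply: eq_bigr => i _; rewrite !mxE.
Qed.

Lemma bracket_rowsub (v : 'cV[R]_n) : bracket (rowsub s v) = bracket v.
Proof. by rewrite /bracket dotv_rowsub. Qed.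

Lemma differentiable_rowsub (x : 'cV[R]_n) :
  differentiable (rowsub s : 'cV[R]_n -> 'cV[R]_n) x.
Proof.
apply: linear_differentiable => u A /nbhs_ballP[e /= e0 eA].
apply/nbhs_ballP; exists e => //= v [_ uv]; apply: eA; split => // i j.
by apply: (le_lt_trans _ (uv (s i) j)); rewrite !mxE.
Qed.

Lemma derive_rowsub (f : 'cV[R]_n -> R) a v :
  'D_v (fun x => f (rowsub s x)) a = 'D_(rowsub s v) f (rowsub s a).
Proof.
exact: (@derive_comp_linear _ _ _ (rowsub s : {linear 'cV[R]_n -> 'cV[R]_n})).
Qed.

Lemma partials_rowsub (w : seq 'I_n) (f : 'cV[R]_n -> R[i]) :
  partials w (fun x => f (rowsub s x)) =
  fun x => partials (map s w) f (rowsub s x).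
Proof.
elim: w => //= i w ->; apply/funext => x; rewrite /cderive.
rewrite (derive_rowsub (fun y => Re (partials (map s w) f y))).
by rewrite (derive_rowsub (fun y => Im (partials (map s w) f y))) rowsub_delta.
Qed.

Lemma smooth_rowsub (f : 'cV[R]_n -> R[i]) :
  smooth f -> smooth (fun x => f (rowsub s x)).
Proof.
move=> sf w x; rewrite partials_rowsub; have [dR dI] := sf (map s w) (rowsub s x).
by split; [move: dR|move: dI] => df;
  apply: (@differentiable_comp _ _ _ _ (rowsub s) _ _ _ df);
  exact: differentiable_rowsub.
Qed.

Lemma partials_conj_rowsub (w : seq 'I_n) (f : 'cV[R]_n -> R[i]) : smooth f ->
  partials w (conj_rowsub f) = conj_rowsub (partials (map s w) f).
Proof.
move=> sf; rewrite /conj_rowsub partials_conj; last exact: smooth_rowsub.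
by rewrite partials_rowsub.
Qed.

Lemma smooth_conj_rowsub (f : 'cV[R]_n -> R[i]) :
  smooth f -> smooth (conj_rowsub f).
Proof.
move=> /smooth_rowsub sf w x; rewrite partials_conj//; have [dR dI] := sf w x; split.
  rewrite (_ : (fun _ => _) = fun y => Re (partials w (fun x => f (rowsub s x)) y))//.
  by apply/funext => y; case: (partials _ _ y).
rewrite (_ : (fun _ => _) = - (fun y => Im (partials w (fun x => f (rowsub s x)) y))).
  exact: differentiableN.
by apply/funext => y; rewrite /GRing.opp/=; case: (partials _ _ y).
Qed.

Lemma cmod_partials_conj_rowsub (w : seq 'I_n) (f : 'cV[R]_n -> R[i]) x :
  smooth f -> cmod (partials w (conj_rowsub f) x) =
              cmod (partials (map s w) f (rowsub s x)).
Proof. by move=> sf; rewrite partials_conj_rowsub// cmod_conj. Qed.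

Lemma Shubin_conj_rowsub m rho (a : 'cV[R]_n -> R[i]) :
  Shubin m rho a -> Shubin m rho (conj_rowsub a).
Proof.
move=> [sa ba]; split; first exact: smooth_conj_rowsub.
move=> w; have [C aC] := ba (map s w); exists C => x.
by rewrite cmod_partials_conj_rowsub// -(bracket_rowsub x) -(size_map s w).
Qed.

Lemma seminorm_le_conj_rowsub k (f : 'cV[R]_n -> R[i]) M :
  smooth f -> seminorm_le k f M -> seminorm_le k (conj_rowsub f) M.
Proof.
move=> sf fM w wk x; rewrite cmod_partials_conj_rowsub// -(bracket_rowsub x).
by apply: fM; rewrite size_map.
Qed.

Lemma is_schwartz_conj_rowsub (f : schwartz R n) : is_schwartz (conj_rowsub f).
Proof.
have [sf bf] := schwartzP f; split; first exact: smooth_conj_rowsub.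
move=> k w; have [C fC] := bf k (map s w); exists C => x.
by rewrite cmod_partials_conj_rowsub// -(bracket_rowsub x).
Qed.

Definition schwartz_conj_rowsub (f : schwartz R n) : schwartz R n :=
  Schwartz (is_schwartz_conj_rowsub f).

Lemma schwartz_ext (f g : schwartz R n) : f =1 g -> f = g.
Proof.
case: f g => [f fP] [g gP] /= /funext fg; subst g.
by rewrite (Prop_irrelevance fP gP).
Qed.

Lemma schwartz_conj_rowsubK : involutive schwartz_conj_rowsub.
Proof. by move=> f; apply: schwartz_ext => x /=; rewrite conj_rowsubK. Qed.

Lemma tempered_ext (u v : tempered R n) : u =1 v -> u = v.
Proof.
case: u v => [u u1 u2] [v v1 v2] /= /funext uv; subst v.
by rewrite (Prop_irrelevance u1 v1) (Prop_irrelevance u2 v2).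
Qed.

Section tempered_conj_rowsub.
Variable u : tempered R n.

(* The outer conjugation compensates the one inside conj_rowsub, so that the
   pairing stays conjugate linear in f. *)
Let pairing (f : schwartz R n) : R[i] := conjc (u (schwartz_conj_rowsub f)).

Let pairing_conj_linear : conj_linear pairing.
Proof.
move=> c f g h hE; rewrite /pairing.
rewrite (@tempered_conj_linear _ _ u (conjc c) (schwartz_conj_rowsub f)
  (schwartz_conj_rowsub g)).
  by rewrite rmorphD rmorphM /= conjcK.
by move=> x /=; rewrite /conj_rowsub hE rmorphD rmorphM.
Qed.

Let pairing_bounded : seminorm_bounded pairing.
Proof.
have [C [k uC]] := tempered_bounded u; exists C, k => f M fM.
rewrite /pairing cmod_conj; apply/uC/seminorm_le_conj_rowsub => //.
by case: (schwartzP f).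
Qed.

Definition tempered_conj_rowsub : tempered R n :=
  Tempered pairing_conj_linear pairing_bounded.
End tempered_conj_rowsub.

Lemma tempered_conj_rowsubK : involutive tempered_conj_rowsub.
Proof.
by move=> u; apply: tempered_ext => f /=; rewrite schwartz_conj_rowsubK conjcK.
Qed.

Lemma tempered_conj_rowsub0 : tempered_conj_rowsub (tempered0 R n) = tempered0 R n.
Proof. by apply: tempered_ext => f; exact: conjc0. Qed.

End conj_rowsub.

(** If P has exactly one element then so has Q, and h relates the two; if not,
    both sides are the default value, which h fixes. *)
Lemma xget_unique_involutive (T : choiceType) (h : T -> T) (x0 : T)
    (P Q : set T) : involutive h -> h x0 = x0 -> (forall u, P u -> Q (h u)) ->
  (forall u, Q u -> P (h u)) -> xget x0 (unique Q) = h (xget x0 (unique P)).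
Proof.
move=> hK hx0 PQ QP; case: (xgetP x0 (unique P)) => [u _ [Pu uP]|nP].
  apply: xget_unique => [|v [Qv _]].
    by split=> [|v /QP/uP ->]; [exact: PQ|rewrite hK].
  by rewrite -[v]hK; congr h; apply/esym/uP/QP.
rewrite hx0; apply: xgetPN => v [Qv vQ]; apply: (nP (h v)); split; first exact: QP.
by move=> w /PQ/vQ ->; rewrite hK.
Qed.

(** * Exchange of the two base variables *)

Section exchange.
Context (d : nat).

Definition swap_halves (i : 'I_(d + d)) : 'I_(d + d) :=
  match fintype.split i with inl j => rshift d j | inr j => lshift d j end.

Lemma swap_halves_lshift j : swap_halves (lshift d j) = rshift d j.
Proof. by rewrite /swap_halves (unsplitK (inl j)). Qed.

Lemma swap_halves_rshift j : swap_halves (rshift d j) = lshift d j.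
Proof. by rewrite /swap_halves (unsplitK (inr j)). Qed.

Lemma swap_halvesK : involutive swap_halves.
Proof.
by move=> i; rewrite -(splitK i); case: fintype.split => j /=;
  rewrite ?(swap_halves_lshift, swap_halves_rshift).
Qed.

Lemma rowsub_swap_halves (T : Type) (x y : 'cV[T]_d) :
  rowsub swap_halves (col_mx x y) = col_mx y x.
Proof.
apply/matrixP => i j; rewrite mxE -(splitK i); case: fintype.split => k /=.
  by rewrite swap_halves_lshift col_mxEu col_mxEd.
by rewrite swap_halves_rshift col_mxEu col_mxEd.
Qed.

Context (N : nat).

Definition swap_base (i : 'I_(d + d + N)) : 'I_(d + d + N) :=
  match fintype.split i with
  | inl j => lshift N (swap_halves j) | inr k => rshift (d + d) k end.

Lemma swap_base_lshift j : swap_base (lshift N j) = lshift N (swap_halves j).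
Proof. by rewrite /swap_base (unsplitK (inl j)). Qed.

Lemma swap_base_rshift j : swap_base (rshift (d + d) j) = rshift (d + d) j.
Proof. by rewrite /swap_base (unsplitK (inr j)). Qed.

Lemma swap_baseK : involutive swap_base.
Proof.
by move=> i; rewrite -(splitK i); case: fintype.split => j /=;
  rewrite ?(swap_base_lshift, swap_base_rshift, swap_halvesK).
Qed.

Lemma usubmx_swap_base (T : Type) (z : 'cV[T]_(d + d + N)) :
  usubmx (rowsub swap_base z) = rowsub swap_halves (usubmx z).
Proof. by apply/matrixP => i j; rewrite !mxE swap_base_lshift. Qed.

Lemma dsubmx_swap_base (T : Type) (z : 'cV[T]_(d + d + N)) :
  dsubmx (rowsub swap_base z) = dsubmx z.
Proof. by apply/matrixP => i j; rewrite !mxE swap_base_rshift. Qed.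

Lemma rowsub_swap_base (T : Type) (X : 'cV[T]_(d + d)) (th : 'cV[T]_N) :
  rowsub swap_base (col_mx X th) = col_mx (rowsub swap_halves X) th.
Proof.
by rewrite -[LHS]vsubmxK usubmx_swap_base dsubmx_swap_base col_mxKu col_mxKd.
Qed.

End exchange.

(** * Symplectic matrices, phases and Lagrangians *)

Section gradients.
Context (R : realType).

(** Where the difference quotients of f diverge, those of - f diverge too and
    both derivatives take the default value 0. *)
Lemma derive_opp n (f : 'cV[R]_n -> R) x v : 'D_v (fun y => - f y) x = - 'D_v f x.
Proof.
have [df|ndf] := pselect (derivable f x v); first exact: deriveN.
have derive_dvg (g : 'cV[R]_n -> R) : ~ derivable g x v -> 'D_v g x = 0.
  by move=> ng; exact: dvgP ng.
rewrite !derive_dvg ?oppr0// => dNf.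
by apply: ndf; rewrite -[f]opprK; exact: derivableN.
Qed.

Lemma grad_opp n (f : 'cV[R]_n -> R) x : grad (fun y => - f y) x = - grad f x.
Proof. by apply/matrixP => i j; rewrite !mxE derive_opp. Qed.

Lemma grad_rowsub n (s : 'I_n -> 'I_n) (f : 'cV[R]_n -> R) x : involutive s ->
  grad (fun y => f (rowsub s y)) x = rowsub s (grad f (rowsub s x)).
Proof.
by move=> sK; apply/matrixP => i j; rewrite !mxE derive_rowsub rowsub_delta.
Qed.

End gradients.

Section symplectic.
Context (R : realType).

(** The symplectic form is nondegenerate: a vector killed by chi is orthogonal
    to everything, hence zero. *)
Lemma Sp_unitmx d (chi : 'M[R]_(d + d)) : Sp chi -> chi \in unitmx.
Proof.
move=> chiS; rewrite -unitmx_tr -row_free_unit; apply: inj_row_free => v vchi.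
have chiv : chi *m v^T = 0 by rewrite -[chi]trmxK -trmx_mul vchi trmx0.
have dotv_delta (x : 'cV[R]_d) i : dotv x (delta_mx i 0) = x i 0.
  rewrite /dotv (bigD1 i)//= mxE !eqxx mulr1 big1 ?addr0// => j ji.
  by rewrite mxE (negbTE ji) mulr0.
have dotv0 (x : 'cV[R]_d) : dotv 0 x = 0.
  by rewrite /dotv big1// => i _; rewrite mxE mul0r.
have dotvC (x y : 'cV[R]_d) : dotv x y = dotv y x.
  by apply: eq_bigr => i _; rewrite mulrC.
have symp0 w : sympl v^T w = 0.
  rewrite -chiS chiv /sympl !linear0 dotv0.
  by rewrite dotvC dotv0 subrr.
apply: trmx_inj; rewrite trmx0 -[LHS]vsubmxK -[RHS]vsubmxK !linear0.
congr col_mx; apply/matrixP => i j; rewrite ord1 [RHS]mxE.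
  (* Momentum directions detect the position part, and conversely. *)
  have := symp0 (col_mx 0 (delta_mx i 0)).
  rewrite /sympl col_mxKu col_mxKd dotv0 dotv_delta sub0r => /eqP.
  by rewrite oppr_eq0 => /eqP.
have := symp0 (col_mx (delta_mx i 0) 0).
by rewrite /sympl col_mxKu col_mxKd dotvC dotv_delta dotvC dotv0 subr0.
Qed.

End symplectic.

Section adjoint_phase.
Context (R : realType) (d N : nat).
Implicit Types phi : 'cV[R]_(d + d + N) -> R.

Definition adjoint_phase phi (z : 'cV[R]_(d + d + N)) : R :=
  - phi (rowsub (@swap_base d N) z).

Lemma adjoint_phaseK : involutive adjoint_phase.
Proof.
move=> phi; apply/funext => z.
by rewrite /adjoint_phase (rowsubK (@swap_baseK d N)) opprK.
Qed.

Lemma phase_function_adjoint phi :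
  phase_function phi -> phase_function (adjoint_phase phi).
Proof.
move=> [F [L [Q [FT QT inj phiE]]]].
have mulF (A : 'M[R]_(d + d)) (X : 'cV[R]_(d + d)) :
    mxsub (@swap_halves d) (@swap_halves d) A *m X =
    rowsub (@swap_halves d) (A *m rowsub (@swap_halves d) X).
  apply/matrixP => i j; rewrite !mxE (reindex_inj (inv_inj (@swap_halvesK d)))/=.
  by apply: eq_bigr => k _; rewrite !mxE swap_halvesK.
have mulL (th : 'cV[R]_N) :
    rowsub (@swap_halves d) L *m th = rowsub (@swap_halves d) (L *m th).
  by apply/matrixP => i j; rewrite !mxE; apply: eq_bigr => k _; rewrite !mxE.
have dotvN n (v w : 'cV[R]_n) : dotv v (- w) = - dotv v w.
  by rewrite /dotv -sumrN; apply: eq_bigr => i _; rewrite mxE mulrN.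
have dotNv n (v w : 'cV[R]_n) : dotv (- v) w = - dotv v w.
  by rewrite /dotv -sumrN; apply: eq_bigr => i _; rewrite mxE mulNr.
(* Substituting S X for X turns F into S F S and L into S L. *)
exists (- mxsub (@swap_halves d) (@swap_halves d) F),
  (- rowsub (@swap_halves d) L), (- Q); split.
- by rewrite linearN/= trmx_mxsub FT.
- by rewrite linearN/= QT.
- move=> th th' /eqP.
  rewrite !mul_col_mx !mulNmx !mulL -!opp_col_mx eqr_opp => /eqP/eq_col_mx[E1 E2].
  apply: inj; rewrite /= !mul_col_mx E2; congr col_mx.
  by rewrite -[LHS](rowsubK (@swap_halvesK d)) E1 (rowsubK (@swap_halvesK d)).
- move=> X th; rewrite /adjoint_phase rowsub_swap_base phiE !mulNmx mulF mulL.
  rewrite !dotvN dotNv !opprD !mulrN.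
  rewrite -[X in dotv X (rowsub _ _)](rowsubK (@swap_halvesK d)).
  rewrite -[X in dotv (rowsub _ _) X](rowsubK (@swap_halvesK d)).
  by rewrite !(dotv_rowsub (@swap_halvesK d)).
Qed.

Definition flip_cotangent (p : 'cV[R]_(d + d) * 'cV[R]_(d + d)) :=
  (rowsub (@swap_halves d) p.1, - rowsub (@swap_halves d) p.2).

Lemma flip_cotangentK : involutive flip_cotangent.
Proof.
by move=> [X Xi]; rewrite /flip_cotangent /= linearN/= opprK !(rowsubK (@swap_halvesK d)).
Qed.

Let Lagrangian_adjoint_sub phi p :
  Lagrangian (adjoint_phase phi) p -> Lagrangian phi (flip_cotangent p).
Proof.
move=> [X [th [-> gth]]]; exists (rowsub (@swap_halves d) X), th; split.
  have -> : (fun X' => adjoint_phase phi (col_mx X' th)) =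
      fun X' => - phi (col_mx (rowsub (@swap_halves d) X') th).
    by apply/funext => X'; rewrite /adjoint_phase rowsub_swap_base.
  rewrite /flip_cotangent /= grad_opp.
  rewrite (grad_rowsub (fun X' => phi (col_mx X' th)) _ (@swap_halvesK d)).
  by rewrite linearN/= opprK (rowsubK (@swap_halvesK d)).
apply/eqP; rewrite -oppr_eq0 -grad_opp -gth; apply/eqP; congr (grad _ _).
by apply/funext => th'; rewrite /adjoint_phase rowsub_swap_base.
Qed.

(** The inclusion from left to right is the chain rule; applied to the adjoint
    phase, whose adjoint is phi, it gives the other one. *)
Lemma Lagrangian_adjoint phi p :
  Lagrangian (adjoint_phase phi) p <-> Lagrangian phi (flip_cotangent p).
Proof.
split; first exact: Lagrangian_adjoint_sub.
rewrite -[phi in X in X -> _]adjoint_phaseK => /Lagrangian_adjoint_sub.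
by rewrite flip_cotangentK.
Qed.

(** The minus sign carried by eta moves to xi under the flip, which restores the
    twisted form with the two points of the graph exchanged. *)
Lemma twisted_graph_flip (chi chi' : 'M[R]_(d + d)) p : chi' *m chi = 1%:M ->
  twisted_graph chi p -> twisted_graph chi' (flip_cotangent p).
Proof.
move=> chiK [x [y [xi [eta [-> E]]]]]; exists y, x, eta, xi; split.
  by rewrite /flip_cotangent /= !rowsub_swap_halves opp_col_mx opprK.
by rewrite E mulmxA chiK mul1mx.
Qed.

Lemma Lagrangian_adjoint_twisted (chi : 'M[R]_(d + d)) phi : Sp chi ->
  Lagrangian phi = twisted_graph chi ->
  Lagrangian (adjoint_phase phi) = twisted_graph (invmx chi).
Proof.
move=> /Sp_unitmx chiU phichi; apply/seteqP; split=> p.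
  move=> /Lagrangian_adjoint; rewrite phichi => /(twisted_graph_flip (mulVmx chiU)).
  by rewrite flip_cotangentK.
move=> /(twisted_graph_flip (mulmxV chiU)); rewrite -phichi.
by move=> /Lagrangian_adjoint.
Qed.

End adjoint_phase.

(** * The adjoint of an oscillatory integral *)

Section adjoint_kernel.
Context (R : realType) (d N : nat).
Implicit Types (phi : 'cV[R]_(d + d + N) -> R) (a : 'cV[R]_(d + d + N) -> R[i]).

Definition adjoint_amplitude a : 'cV[R]_(d + d + N) -> R[i] :=
  conj_rowsub (@swap_base d N) a.

Definition kernel_adjoint : tempered R (d + d) -> tempered R (d + d) :=
  tempered_conj_rowsub (@swap_halvesK d).

(** Conjugation changes the sign of the phase, and the change of variables
    z -> S z moves S from the phase and amplitude to the test function; S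
    leaves theta, hence the cutoff, unchanged. *)
Lemma regularized_integral_adjoint phi a (kappa : 'cV[R]_N -> R[i])
    (f : 'cV[R]_(d + d) -> R[i]) eps :
  regularized_integral (adjoint_phase phi) (adjoint_amplitude a) kappa f eps =
  conjc (regularized_integral phi a (fun th => conjc (kappa th))
          (conj_rowsub (@swap_halves d) f) eps).
Proof.
rewrite /regularized_integral -cintegral_conj.
rewrite -[RHS](cintegral_rowsub _ (@swap_baseK d N)).
congr cintegral; apply/funext => z.
rewrite usubmx_swap_base dsubmx_swap_base /adjoint_amplitude /conj_rowsub.
rewrite (rowsubK (@swap_halvesK d)) !rmorphM /= !conjcK.
congr (_ * _ * _ * _).
by rewrite /expi /adjoint_phase cosN sinN.
Qed.

Lemma oscillatory_limit_adjoint phi a u :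
  oscillatory_limit phi a u ->
  oscillatory_limit (adjoint_phase phi) (adjoint_amplitude a) (kernel_adjoint u).
Proof.
move=> ua kappa kappa1 f.
have [|cR cI] := ua (schwartz_conj kappa) _ (schwartz_conj_rowsub (@swap_halvesK d) f).
  by move=> th /kappa1 /= ->; rewrite conjc1.
have ReE eps :
    Re (regularized_integral (adjoint_phase phi) (adjoint_amplitude a) kappa f eps) =
    Re (regularized_integral phi a (schwartz_conj kappa)
          (schwartz_conj_rowsub (@swap_halvesK d) f) eps).
  by rewrite regularized_integral_adjoint; case: (regularized_integral phi a _ _ eps).
have ImE eps :
    Im (regularized_integral (adjoint_phase phi) (adjoint_amplitude a) kappa f eps) =
    - Im (regularized_integral phi a (schwartz_conj kappa)
          (schwartz_conj_rowsub (@swap_halvesK d) f) eps).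
  by rewrite regularized_integral_adjoint; case: (regularized_integral phi a _ _ eps).
split.
  under eq_fun do rewrite ReE.
  have -> : Re (kernel_adjoint u f) = Re (u (schwartz_conj_rowsub (@swap_halvesK d) f)).
    by rewrite /=; case: (u _).
  exact: cR.
under eq_fun do rewrite ImE.
have -> : Im (kernel_adjoint u f) = - Im (u (schwartz_conj_rowsub (@swap_halvesK d) f)).
  by rewrite /=; case: (u _).
exact: cvgN.
Qed.

Lemma oscillatory_integral_adjoint phi a :
  oscillatory_integral (adjoint_phase phi) (adjoint_amplitude a) =
  kernel_adjoint (oscillatory_integral phi a).
Proof.
apply: xget_unique_involutive.
- exact: tempered_conj_rowsubK.
- exact: tempered_conj_rowsub0.
- by move=> u; exact: oscillatory_limit_adjoint.
- move=> u /oscillatory_limit_adjoint; rewrite adjoint_phaseK.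
  by rewrite /adjoint_amplitude (conj_rowsubK (@swap_baseK d N)).
Qed.

(** Conjugating f (x) conj g and exchanging the variables yields
    g (x) conj f, the test function that defines the original operator. *)
Lemma formal_adjoint_kernel_op (K : tempered R (d + d)) :
  formal_adjoint (kernel_op K) (kernel_op (kernel_adjoint K)).
Proof.
move=> f g /=; rewrite conjcK; congr (K _); apply: schwartz_ext => z /=.
rewrite /conj_rowsub /tens rmorphM /= conjcK mulrC -[z in RHS]vsubmxK rowsub_swap_halves.
by rewrite col_mxKu col_mxKd.
Qed.

End adjoint_kernel.

Theorem proposition4p11 (R : realType) (d N : nat) (m rho : R)
    (chi : 'M[R]_(d + d))
    (phi psi : 'cV[R]_(d + d + N) -> R) (a b : 'cV[R]_(d + d + N) -> R[i]) :
  0 <= rho <= 1 ->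
  Sp chi ->
  phase_function phi ->
  Lagrangian phi = twisted_graph chi ->
  Shubin m rho a ->
  (forall (x y : 'cV[R]_d) (th : 'cV[R]_N),
    psi (col_mx (col_mx x y) th) = - phi (col_mx (col_mx y x) th)) ->
  (forall (x y : 'cV[R]_d) (th : 'cV[R]_N),
    b (col_mx (col_mx x y) th) = conjc (a (col_mx (col_mx y x) th))) ->
  formal_adjoint (FIO phi a) (FIO psi b) /\
  [/\ phase_function psi, Lagrangian psi = twisted_graph (invmx chi),
      Shubin m rho b & FIO_class m rho (invmx chi) (FIO psi b)].
Proof.
move=> _ chiS phiP phichi aS psiE bE.
have -> : psi = adjoint_phase phi.
  apply/funext => z; rewrite -[z]vsubmxK -[usubmx z]vsubmxK psiE /adjoint_phase.
  by rewrite rowsub_swap_base rowsub_swap_halves.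
have -> : b = adjoint_amplitude a.
  apply/funext => z; rewrite -[z]vsubmxK -[usubmx z]vsubmxK bE.
  by rewrite /adjoint_amplitude /conj_rowsub rowsub_swap_base rowsub_swap_halves.
have psiP := phase_function_adjoint phiP.
have psichi := Lagrangian_adjoint_twisted chiS phichi.
have bS : Shubin m rho (adjoint_amplitude a).
  exact: (Shubin_conj_rowsub (@swap_baseK d N)).
split.
  by rewrite /FIO oscillatory_integral_adjoint; exact: formal_adjoint_kernel_op.
split=> //.
exists (oscillatory_integral (adjoint_phase phi) (adjoint_amplitude a)) => //.
by exists N, (adjoint_phase phi), (adjoint_amplitude a).
Qed.
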